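(* Let $\mathcal{X}:f(x,y,z)=0$ be a real surface of revolution with axis the $x$-axis, $f\in\mathbb{R}[x,y,z]$ absolutely irreducible, with profile curve $p(x,y)=f(x,y,0)=\sum_i p_i(x)y^{2i}$, and let $\mathcal{P}^2:\sum_i p_i(x)y^i=0$. Suppose $\mathcal{P}^2$ is rational and let $t\mapsto\big(p(t)/q(t),\,r(t)/q(t)\big)$, $p,q,r\in\mathbb{R}[t]$, be a proper parameterization of $\mathcal{P}^2$. Put $g=\gcd(r,q)$, $\tilde r=r/g$, $\tilde q=q/g$, $\tilde p = p/g$, and write $\tilde r\,\tilde q=h\,d^2$ with $h,d\in\mathbb{R}[t]$ and $h$ square-free (so $h=\hat r\hat q$ with $\hat r,\hat q$ the square-free parts of $\tilde r,\tilde q$, $\gcd(\hat r,\hat q)=1$). Then $\mathcal{X}$ is birationally equivalent to the tubular surface $$\mathcal{T}:\ y^2+z^2-h(x)=0,$$ and a birational map $\tau:\mathcal{T}\dashrightarrow\mathcal{X}$ is given by $$\tau(x,y,z)=\Big(\frac{\tilde p(x)}{\tilde q(x)},\ \frac{d(x)\,y}{\tilde q(x)},\ \frac{d(x)\,z}{\tilde q(x)}\Big).$$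
   Context: A surface of revolution (SOR): rotate an algebraic space curve $\mathcal{G}$ (distinct from the line $\mathcal{A}$ and not a line perpendicular to $\mathcal{A}$) about a line $\mathcal{A}\subset\mathbb{R}^3$. Absolutely irreducible means not a product of two non-constant polynomials in $\mathbb{C}[x,y,z]$. A parameterization is proper if it has a rational inverse. A tubular surface is a surface with equation $A(x)y^2+B(x)z^2+C(x)=0$. *)

(* Defs.v *)
From HB Require Import structures.
From mathcomp Require Import all_boot all_order all_algebra.
From mathcomp Require Import complex.
From mathcomp Require Import mpoly.
Set Implicit Arguments. Unset Strict Implicit. Unset Printing Implicit Defensive.
Import Order.TTheory GRing.Theory Num.Theory.
Local Open Scope ring_scope.
Local Open Scope complex_scope.

Section Defs.
Variable R : rcfType.

Definition toC (x : R) : R[i] := x%:C.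

Definition cmeval n (p : {mpoly R[n]}) (v : 'I_n -> R[i]) : R[i] :=
  (map_mpoly toC p).@[v].

Definition cpeval (p : {poly R}) (t : R[i]) : R[i] := (map_poly toC p).[t].

Definition pt2 (x y : R[i]) : 'I_2 -> R[i] := fun i => [:: x; y]`_i.
Definition pt3 (x y z : R[i]) : 'I_3 -> R[i] := fun i => [:: x; y; z]`_i.
Definition rpt3 (x y z : R) : 'I_3 -> R := fun i => [:: x; y; z]`_i.

Definition upoly_in n (i : 'I_n) (u : {poly R}) : {mpoly R[n]} :=
  (map_poly (@mpolyC n R) u).['X_i].

Definition mnonconst n (K : nzRingType) (g : {mpoly K[n]}) := (1 < msize g)%N.

Definition abs_irreducible (f : {mpoly R[3]}) :=
  mnonconst f /\
  forall g h : {mpoly R[i][3]}, map_mpoly toC f = g * h ->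
    ~~ mnonconst g || ~~ mnonconst h.

(** Surface of revolution with axis the x-axis: the defining polynomial is
    invariant under all rotations about the x-axis, and the surface is not a
    plane perpendicular to the axis (f is not a polynomial in x alone). *)
Definition SOR_xaxis (f : {mpoly R[3]}) :=
  (forall c s x y z : R, c ^+ 2 + s ^+ 2 = 1 ->
      f.@[rpt3 x (c * y - s * z) (s * y + c * z)] = f.@[rpt3 x y z]) /\
  ~ (forall x y z : R, f.@[rpt3 x y z] = f.@[rpt3 x 0 0]).

Definition param_pt (p q r : {poly R}) (t : R[i]) :=
  pt2 (cpeval p t / cpeval q t) (cpeval r t / cpeval q t).

Definition proper_param (P2 : {mpoly R[2]}) (p q r : {poly R}) :=
  q != 0 /\
  (forall t : R[i], cpeval q t != 0 -> cmeval P2 (param_pt p q r t) = 0) /\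
  exists a b : {mpoly R[2]},
    (exists t : R[i], cpeval q t != 0 /\ cmeval b (param_pt p q r t) != 0) /\
    (forall t : R[i], cpeval q t != 0 -> cmeval b (param_pt p q r t) != 0 ->
       cmeval a (param_pt p q r t) = t * cmeval b (param_pt p q r t)).

Definition squarefree (h : {poly R}) :=
  h != 0 /\ forall u : {poly R}, (u ^+ 2 %| h)%R -> (size u <= 1)%N.

(** Rational maps of (complex) 3-space with real coefficients, given by
    numerator/denominator pairs for each coordinate. *)
Definition rmap3 := 'I_3 -> {mpoly R[3]} * {mpoly R[3]}.

Definition rdefined (Phi : rmap3) (P : 'I_3 -> R[i]) :=
  forall i, cmeval (Phi i).2 P != 0.

Definition rapply (Phi : rmap3) (P : 'I_3 -> R[i]) : 'I_3 -> R[i] :=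
  fun i => cmeval (Phi i).1 P / cmeval (Phi i).2 P.

Definition onV (F : {mpoly R[3]}) (P : 'I_3 -> R[i]) := cmeval F P = 0.

Definition rational_map (F G : {mpoly R[3]}) (Phi : rmap3) :=
  (exists P, onV F P /\ rdefined Phi P) /\
  (forall P, onV F P -> rdefined Phi P -> onV G (rapply Phi P)).

(** Phi : V(F) --> V(G) is birational: it has a rational inverse (with real
    coefficients), the compositions being defined on nonempty (hence dense)
    open subsets and equal to the identity wherever defined. *)
Definition birational (F G : {mpoly R[3]}) (Phi : rmap3) :=
  rational_map F G Phi /\
  exists Psi : rmap3, rational_map G F Psi /\
    (exists P, onV F P /\ rdefined Phi P /\ rdefined Psi (rapply Phi P)) /\
    (exists Q, onV G Q /\ rdefined Psi Q /\ rdefined Phi (rapply Psi Q)) /\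
    (forall P, onV F P -> rdefined Phi P -> rdefined Psi (rapply Phi P) ->
       forall i, rapply Psi (rapply Phi P) i = P i) /\
    (forall Q, onV G Q -> rdefined Psi Q -> rdefined Phi (rapply Psi Q) ->
       forall i, rapply Phi (rapply Psi Q) i = Q i).

Definition tubular (h : {poly R}) : {mpoly R[3]} :=
  'X_1 ^+ 2 + 'X_2 ^+ 2 - upoly_in 0 h.

(** The map tau(x,y,z) = (p~(x)/q~(x), d(x) y/q~(x), d(x) z/q~(x)),
    where p~/q~ = (p/g)/(q/g) = p/q. *)
Definition tau_map (p q qt d : {poly R}) : rmap3 :=
  fun i => [:: (upoly_in 0 p, upoly_in 0 q);
               (upoly_in 0 d * 'X_1, upoly_in 0 qt);
               (upoly_in 0 d * 'X_2, upoly_in 0 qt)]`_i.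

End Defs.

(* Main.v *)
(** Rotation invariance gives [f(x,y,z) = P2(x, y^2 + z^2)] at all real points,
    hence as polynomials, so a factorization of [P2] would give one of [f] and
    [P2] is irreducible. On [y^2 + z^2 = h(x)] the radius of the image of [tau] is
    [d^2 h / qt^2 = rt / qt = r / q], so [tau] lands on the surface. If [a / b] is
    the inverse of the parameterization, then [t = a(x, y^2+z^2) / b(x, y^2+z^2)],
    [y qt(t) / d(t)], [z qt(t) / d(t)] is the inverse of [tau]: the relations
    [x q(t) = p(t)] and [(y^2+z^2) q(t) = r(t)], cleared of denominators, vanish on
    the parameterized points, and therefore on the whole curve [P2 = 0] because
    [P2] is irreducible. That [d <> 0], i.e. [r <> 0], follows from the absolute
    irreducibility of [f], since [r = 0] forces [f = c (y^2 + z^2)]. *)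

Require Import Defs.
From HB Require Import structures.
From mathcomp Require Import all_boot all_order all_algebra.
From mathcomp Require Import complex.
From mathcomp Require Import mpoly ring.
Set Implicit Arguments. Unset Strict Implicit. Unset Printing Implicit Defensive.
Import Order.TTheory GRing.Theory Num.Theory.
Local Open Scope ring_scope.

(** * Irreducible bivariate polynomials vanishing on a rational curve *)

(* Elements of [{poly {poly K}}] are polynomials in the outer variable [y] over
   [K[x]]. *)
Definition ev2 (K : comNzRingType) (A : {poly {poly K}}) (x y : K) : K := A.[y%:P].[x].

Definition const2 (K : nzRingType) (A : {poly {poly K}}) := exists c : K, A = c%:P%:P.

Definition irred2 (K : nzRingType) (B : {poly {poly K}}) :=
  ~ const2 B /\ forall A1 A2, B = A1 * A2 -> const2 A1 \/ const2 A2.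

Lemma ev2M (K : comNzRingType) (A B : {poly {poly K}}) x y :
  ev2 (A * B) x y = ev2 A x y * ev2 B x y.
Proof. by rewrite /ev2 !hornerM. Qed.

Lemma ev2_map (K : comNzRingType) (A : {poly {poly K}}) x y :
  ev2 A x y = (map_poly (horner_eval x) A).[y].
Proof.
rewrite /ev2; have := horner_map (horner_eval x) A y%:P.
by rewrite /= /horner_eval hornerC.
Qed.

Lemma poly2_XsubC_dvd (K : comNzRingType) (A : {poly {poly K}}) c :
  map_poly (horner_eval c) A = 0 -> exists A', A = ('X - c%:P) *: A'.
Proof.
move=> /polyP A0.
have H i : exists u, A`_i = u * ('X - c%:P).
  apply/factor_theorem/rootP; move: (A0 i); rewrite coef_map coef0 /=.
  exact.
(* [H] yields the quotients one coefficient at a time; the induction collects them in a list, which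
   becomes the cofactor. *)
have [s Hs] : exists s : seq {poly K}, size s = size A /\
    forall i, (i < size A)%N -> A`_i = s`_i * ('X - c%:P).
  elim: (size A) => [|n [s [ss Hs]]]; first by exists [::].
  have [u Hu] := H n; exists (rcons s u); rewrite size_rcons ss; split=> // i.
  by rewrite ltnS leq_eqVlt nth_rcons ss => /orP[/eqP ->|lin];
    [rewrite ltnn eqxx | rewrite lin Hs].
exists (Poly s); apply/polyP => i; rewrite coefZ coef_Poly.
have [ltiA|leAi] := ltnP i (size A); first by rewrite Hs.2 // mulrC.
by rewrite !nth_default ?mulr0 // Hs.1.
Qed.

Section ClosedField.
Variable K : closedFieldType.
Implicit Types (A B D G Q : {poly {poly K}}) (c u v p q r : {poly K}).

(* Gauss' lemma: the linear factors of [c] divide [D] or [Q] one at a time. *)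
Lemma cancel_content c B D Q : c != 0 -> c *: B = D * Q ->
  exists D' Q' u v, [/\ B = D' * Q', D = u *: D' & Q = v *: Q'].
Proof.
have [n] := ubnP (size c); elim: n => // n IH in c D Q *; rewrite ltnS => sc nzc E.
have [c1|c1] := boolP (size c == 1%N).
  have /size_poly1P[k nzk ck] := c1.
  exists D, ((k^-1)%:P *: Q), 1, k%:P; split; rewrite ?scale1r //.
    by rewrite -scalerAr -E scalerA ck -polyCM mulVf // scale1r.
  by rewrite scalerA -polyCM mulfV // scale1r.
have /closed_rootP[a /factor_theorem[c' Ec]] := c1.
have nzXa : 'X - a%:P != 0 :> {poly K} by rewrite polyXsubC_eq0.
have nzc' : c' != 0 by apply: contraNneq nzc => c'0; rewrite Ec c'0 mul0r.
have sc' : (size c' < n)%N.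
  apply: leq_trans sc; rewrite Ec size_Mmonic ?monicXsubC // size_XsubC addn2.
  by rewrite ltnS.
(* At a root [a] of [c] the product vanishes identically in [y]; since [K[y]] is a domain, one
   factor does, and [x - a] can be cancelled from it. *)
have: map_poly (horner_eval a) (D * Q) = 0.
  rewrite -E -mul_polyC rmorphM /= map_polyC /= Ec /horner_eval hornerM.
  by rewrite !hornerE subrr mulr0 polyC0 mul0r.
rewrite rmorphM /= => /eqP; rewrite mulf_eq0 => /orP[/eqP|/eqP] /poly2_XsubC_dvd [A' EA].
  have /(IH _ _ _ sc' nzc')[D' [Q' [u [v [-> ED EQ]]]]] : c' *: B = A' * Q.
    apply: (@mulfI _ ('X - a%:P)%:P); rewrite ?polyC_eq0 // !mul_polyC.
    by rewrite scalerA mulrC -Ec E EA scalerAl.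
  by exists D', Q', (('X - a%:P) * u), v; rewrite EA {1}ED scalerA.
have /(IH _ _ _ sc' nzc')[D' [Q' [u [v [-> ED EQ]]]]] : c' *: B = D * A'.
  apply: (@mulfI _ ('X - a%:P)%:P); rewrite ?polyC_eq0 // !mul_polyC.
  by rewrite scalerA mulrC -Ec E EA scalerAr.
by exists D', Q', u, (('X - a%:P) * v); rewrite EA {1}EQ scalerA.
Qed.

Lemma const2_size A : const2 A -> (size A <= 1)%N.
Proof. by case=> c ->; apply: size_polyC_leq1. Qed.

(** Up to a factor in [K[x]], the common factor [D] is [B] itself, because [B] is irreducible. So
    [B] divides a [K[x]]-multiple of [G], and Gauss' lemma makes it divide [G]. *)
Lemma irred2_common_zero B D G c1 c2 Q1 Q2 x y : irred2 B ->
  c1 != 0 -> c1 *: B = D * Q1 -> c2 != 0 -> c2 *: G = D * Q2 ->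
  (1 < size D)%N -> ev2 B x y = 0 -> ev2 G x y = 0.
Proof.
move=> [ncB irrB] nz1 E1 nz2 E2 sD.
have [D' [Q1' [u1 [v1 [EB ED _]]]]] := cancel_content nz1 E1.
have sD' : (1 < size D')%N by apply: leq_trans sD _; rewrite ED size_scale_leq.
have [/const2_size|[k Ek]] := irrB _ _ EB; first by rewrite leqNgt sD'.
have nzB : B != 0 by apply/eqP => B0; apply: ncB; exists 0; rewrite B0 !polyC0.
have nzk : k != 0 by apply: contraNneq nzB => k0; rewrite EB Ek k0 !polyC0 mulr0.
have sB : (1 < size B)%N by rewrite EB Ek mulrC mul_polyC size_scale // polyC_eq0.
have EDB : D = (u1 * (k^-1)%:P) *: B.
  by rewrite ED EB Ek [D' * _]mulrC mul_polyC scalerA -mulrA -polyCM mulVf // mulr1.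
have {}E2 : c2 *: G = B * ((u1 * (k^-1)%:P) *: Q2).
  by rewrite E2 EDB -scalerAl -scalerAr.
have [B' [Q' [u [v [EG EB' _]]]]] := cancel_content nz2 E2.
have EuB : B = u%:P * B' by rewrite mul_polyC.
(* [B] involves [y], hence so does [B'], and the constant factor must be [u]. *)
have [[k' /polyC_inj Ek']|/const2_size sB'] := irrB _ _ EuB; last first.
  by move: sB; rewrite EB' ltnNge (leq_trans (size_scale_leq _ _) sB').
have nzk' : k' != 0 by apply: contraNneq nzB => k0; rewrite EuB Ek' k0 !polyC0 mul0r.
rewrite EG EuB Ek' !ev2M => /eqP; rewrite mulf_eq0 => /orP[|/eqP ->]; last by rewrite mul0r.
by rewrite /ev2 !hornerC (negPf nzk').
Qed.

(* The hypothesis says that [p / q] is nonconstant, so it takes infinitely many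
   values. *)
Lemma ratfun_poly_eq0 p q u : q != 0 -> (forall c : K, p != c *: q) ->
  (forall t, q.[t] != 0 -> u.[p.[t] / q.[t]] = 0) -> u = 0.
Proof.
move=> nzq ncpq u0; apply/eqP/negPn/negP => nzu.
have [s Eu] := closed_field_poly_normal u.
(* Where this product is nonzero, [q] is nonzero and [p / q] avoids all roots of [u]. *)
have nzF : q * \prod_(a <- s) (p - a *: q) != 0.
  rewrite mulf_neq0 // prodf_seq_neq0; apply/allP => a _ /=.
  by rewrite subr_eq0.
have /closed_nonrootP[t] := nzF.
rewrite rootM negb_or => /andP[qt]; apply/negP/negPn.
have := u0 t qt; rewrite {1}Eu hornerZ horner_prod.
move/eqP; rewrite mulf_eq0 lead_coef_eq0 (negPf nzu) /= prodf_seq_eq0.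
case/hasP=> a sa; rewrite hornerXsubC subr_eq0 => /eqP Ea.
rewrite /root horner_prod prodf_seq_eq0; apply/hasP; exists a => //=.
by rewrite !hornerE -Ea divfK ?subrr.
Qed.

(** Leading coefficients leave a single candidate for the scalar. *)
Lemma scalar_multiple p q : q != 0 ->
  (exists c : K, p = c *: q) \/ (forall c : K, p != c *: q).
Proof.
move=> nzq; have [E|ne] := eqVneq p ((lead_coef p / lead_coef q) *: q).
  by left; exists (lead_coef p / lead_coef q).
right=> c; apply: contra_neq ne => E.
by rewrite {2}E lead_coefZ mulfK ?lead_coef_eq0.
Qed.

(* Replaces the statement that the curve is the closure of the image of its
   parameterization. If [p / q] is nonconstant, the resultant of [B] and [G] in [y]
   vanishes at all its values, so [B] and [G] share a factor over [K(x)]; otherwise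
   [B] is a multiple of [x - c]. *)
Lemma irred2_param_zero B G p q r x y : irred2 B -> q != 0 ->
  ~ (exists c1 c2 : K, p = c1 *: q /\ r = c2 *: q) ->
  (forall t, q.[t] != 0 -> ev2 B (p.[t] / q.[t]) (r.[t] / q.[t]) = 0) ->
  (forall t, q.[t] != 0 -> ev2 G (p.[t] / q.[t]) (r.[t] / q.[t]) = 0) ->
  ev2 B x y = 0 -> ev2 G x y = 0.
Proof.
move=> iB nzq ncst B0 G0; have [ncB irrB] := iB.
have nzB : B != 0 by apply/eqP => E; apply: ncB; exists 0; rewrite E !polyC0.
have [[c Ec]|ncp] := scalar_multiple p nzq; last first.
  (* Settles degree 0 in [y], where the resultant argument below does not apply. *)
  have res0 A : (size A <= 1)%N ->
      (forall t, q.[t] != 0 -> ev2 A (p.[t] / q.[t]) (r.[t] / q.[t]) = 0) -> A = 0.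
    move=> /size1_polyC -> A0; congr _%:P; apply: (ratfun_poly_eq0 nzq ncp) => t qt.
    by have := A0 t qt; rewrite /ev2 hornerC.
  have [sB|sB] := leqP (size B) 1; first by rewrite (res0 B sB B0) eqxx in nzB.
  have [sG|sG] := leqP (size G) 1; first by rewrite (res0 G sG G0) /ev2 !horner0.
  have [uv _ Euv] := resultant_in_ideal sB sG.
  have /eqP : resultant B G = 0.
    apply: (ratfun_poly_eq0 nzq ncp) => t qt.
    have := congr1 (fun A => ev2 A (p.[t] / q.[t]) (r.[t] / q.[t])) Euv.
    rewrite /ev2 hornerC => ->; rewrite !hornerD -!/(ev2 _ _ _) !ev2M.
    by rewrite B0 // G0 // !mulr0 addr0.
  rewrite resultant_eq0 => sD.
  have /Pdiv.Idomain.dvdpP[[c1 Q1] /= nz1 E1] := dvdp_gcdl B G.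
  have /Pdiv.Idomain.dvdpP[[c2 Q2] /= nz2 E2] := dvdp_gcdr B G.
  rewrite [Q1 * _]mulrC in E1; rewrite [Q2 * _]mulrC in E2.
  exact: (irred2_common_zero _ nz1 E1 nz2 E2).
(* Now [p / q] is the constant [c], so [r / q] is not constant, and a polynomial vanishing on the
   curve vanishes on the whole line [x = c]. *)
have ncr (c1 : K) : r != c1 *: q by apply/eqP => Er; apply: ncst; exists c, c1.
have fiber A : (forall t, q.[t] != 0 -> ev2 A (p.[t] / q.[t]) (r.[t] / q.[t]) = 0) ->
    exists A', A = ('X - c%:P) *: A'.
  move=> A0; apply: poly2_XsubC_dvd; apply: (ratfun_poly_eq0 nzq ncr) => t qt.
  by have := A0 t qt; rewrite Ec hornerZ mulfK // ev2_map.
have [G' ->] := fiber G G0.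
have [B' EB] := fiber B B0.
have ev2Z u A : ev2 (u *: A) x y = u.[x] * ev2 A x y.
  by rewrite /ev2 hornerZ hornerM.
have /irrB : B = ('X - c%:P)%:P * B' by rewrite mul_polyC.
case=> [[k /polyC_inj /(congr1 (size \o polyseq))]|[k EB']].
  by rewrite /= size_XsubC size_polyC; case: (k != 0).
rewrite EB !ev2Z EB' {1}/ev2 !hornerC => /eqP; rewrite mulf_eq0.
case/orP => [/eqP ->|/eqP k0]; first by rewrite mul0r.
by rewrite EB EB' k0 !polyC0 scaler0 eqxx in nzB.
Qed.

End ClosedField.

(** * Polynomial identities from evaluations *)

Lemma mpoly_rmorph_ext (K : comNzRingType) n (S : comNzRingType)
    (phi psi : {rmorphism {mpoly K[n]} -> S}) :
  (forall c, phi c%:MP = psi c%:MP) -> (forall i, phi 'X_i = psi 'X_i) ->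
  phi =1 psi.
Proof.
move=> eqC eqX P; rewrite [P]mpolyE !rmorph_sum; apply: eq_bigr => m _.
rewrite -mul_mpolyC !rmorphM eqC mpolyXE_id !rmorph_prod; congr (_ * _).
by apply: eq_bigr => i _; rewrite !rmorphXn eqX.
Qed.

Section Infinite.
Variable K : numDomainType.

Lemma poly_fun_eq0 (p : {poly K}) : (forall k : nat, p.[k%:R] = 0) -> p = 0.
Proof.
move=> p0; apply/eqP/negPn/negP => nzp.
have uR : uniq [seq i%:R : K | i <- iota 0 (size p)].
  by rewrite map_inj_uniq ?iota_uniq // => i j /eqP; rewrite eqr_nat => /eqP.
have /(max_poly_roots nzp)/(_ uR) : all (root p) [seq i%:R | i <- iota 0 (size p)].
  by apply/allP => _ /mapP[k _ ->]; apply/rootP.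
by rewrite size_map size_iota ltnn.
Qed.

(** Singles out the last variable, for induction on the number of variables. *)
Definition mpoly_uni n : {mpoly K[n.+1]} -> {poly {mpoly K[n]}} :=
  mmap (polyC \o @mpolyC n K)
       (fun i => oapp (fun j => ('X_j)%:P) 'X (unlift ord_max i)).

Definition mpoly_of_uni n : {poly {mpoly K[n]}} -> {mpoly K[n.+1]} :=
  horner_eval 'X_ord_max \o
  map_poly (mmap (@mpolyC n.+1 K) (fun j => 'X_(lift ord_max j))).

Lemma mpoly_uniK n : cancel (@mpoly_uni n) (@mpoly_of_uni n).
Proof.
apply: (mpoly_rmorph_ext (phi := @mpoly_of_uni n \o @mpoly_uni n) (psi := idfun)).
  move=> c /=; rewrite /mpoly_of_uni /mpoly_uni mmapC /= map_polyC /= /horner_eval.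
  by rewrite hornerC mmapC.
move=> i /=; rewrite /mpoly_of_uni /mpoly_uni mmapX mmap1U /=.
case: unliftP => [j|] -> /=; rewrite /horner_eval.
  by rewrite map_polyC hornerC /= mmapX mmap1U.
by rewrite map_polyX hornerX.
Qed.

Lemma meval_mpoly_uni n (P : {mpoly K[n.+1]}) (v : 'I_n -> K) x :
  (map_poly (meval v) (mpoly_uni P)).[x]
  = P.@[fun i => oapp v x (unlift ord_max i)].
Proof.
pose psi := horner_eval x \o map_poly (meval v) \o @mpoly_uni n.
have := @mpoly_rmorph_ext _ _ _ psi (meval (fun i => oapp v x (unlift ord_max i))).
apply => [c|i]; rewrite /psi /= /horner_eval /mpoly_uni.
  by rewrite mmapC /= map_polyC hornerC /= !mevalC.
rewrite mmapX mmap1U mevalXU; case: unliftP => [j|] _ /=.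
  by rewrite map_polyC hornerC /= mevalXU.
by rewrite map_polyX hornerX.
Qed.

(** By induction, each coefficient in the last variable vanishes. Testing at natural points only
    lets an identity known at real points be proved over the complex numbers. *)
Lemma mpoly_fun_eq0 n (P : {mpoly K[n]}) :
  (forall v : 'I_n -> nat, P.@[fun i => (v i)%:R] = 0) -> P = 0.
Proof.
elim: n => [|n IH] in P * => P0.
  have EP : P = (P@_0)%:MP.
    apply/mpolyP => m; have -> : m = 0%MM by apply/mnmP; case.
    by rewrite mcoeffC eqxx mulr1.
  by have := P0 (fun=> 0%N); rewrite EP mevalC => ->; rewrite mpolyC0.
rewrite -[P]mpoly_uniK; suff -> : mpoly_uni P = 0 by rewrite /mpoly_of_uni rmorph0.
apply/polyP => k; rewrite coef0; apply: IH => v.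
have /(congr1 (fun u : {poly K} => u`_k)) :
    map_poly (meval (fun i => (v i)%:R)) (mpoly_uni P) = 0.
  apply: poly_fun_eq0 => x; rewrite meval_mpoly_uni.
  rewrite -[RHS](P0 (fun i => oapp v x (unlift ord_max i))).
  by apply: meval_eq => i; case: unliftP.
by rewrite coef0 coef_map.
Qed.

End Infinite.

Definition poly2_of (K : comNzRingType) : {mpoly K[2]} -> {poly {poly K}} :=
  mmap (polyC \o polyC) (fun i : 'I_2 => [:: 'X%:P; 'X]`_i).

Lemma ev2_poly2_of (K : comNzRingType) (P : {mpoly K[2]}) (v : 'I_2 -> K) :
  ev2 (poly2_of P) (v 0) (v 1) = P.@[v].
Proof.
pose psi := horner_eval (v 0) \o horner_eval (v 1)%:P \o @poly2_of K.
have := @mpoly_rmorph_ext _ _ _ psi (meval v).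
apply => [c|i]; rewrite /psi /= /horner_eval /poly2_of.
  by rewrite mmapC /= !hornerC mevalC.
rewrite mmapX mmap1U mevalXU.
case: i => -[|[|//]] Hi /=; rewrite ?hornerC ?hornerX ?hornerC;
 by congr v; apply: val_inj.
Qed.

(* [A(x, y)] becomes [A(x, y^2 + z^2)]. *)
Definition revolve (K : comNzRingType) : {poly {poly K}} -> {mpoly K[3]} :=
  horner_eval ('X_1 ^+ 2 + 'X_2 ^+ 2) \o
  map_poly (horner_eval 'X_0 \o map_poly (@mpolyC 3 K)).

Lemma meval_revolve (K : comNzRingType) (A : {poly {poly K}}) v :
  (revolve A).@[v] = ev2 A (v 0) (v 1 ^+ 2 + v 2 ^+ 2).
Proof.
rewrite /revolve /= /horner_eval -horner_map -map_poly_comp.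
rewrite rmorphD !rmorphXn /= !mevalXU ev2_map; congr (_.[_]).
apply: eq_map_poly => u /=; rewrite /horner_eval -horner_map -map_poly_comp.
by rewrite /= mevalXU map_poly_id // => c _ /=; rewrite mevalC.
Qed.

(** * The equation of a surface of revolution *)

HB.instance Definition _ (R : rcfType) :=
  GRing.RMorphism.copy (@toC R) (@real_complex R).

Section Revolution.
Variable R : rcfType.
Local Notation C := R[i].

Lemma ev2_cmeval (P : {mpoly R[2]}) (x y : C) :
  ev2 (poly2_of (map_mpoly (@toC R) P)) x y = cmeval P (pt2 x y).
Proof. exact: (ev2_poly2_of _ (pt2 x y)). Qed.

Lemma cmeval_real n (P : {mpoly R[n]}) (v : 'I_n -> R) (w : 'I_n -> C) :
  (forall i, w i = toC (v i)) -> cmeval P w = toC P.@[v].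
Proof.
move=> Ew; have := @mpoly_rmorph_ext _ _ _
  (meval w \o map_mpoly (@toC R)) (@toC R \o meval v).
apply => [c|i] /=; first by rewrite map_mpolyC !mevalC.
by rewrite map_mpolyX !mevalXU Ew.
Qed.

(** A rotation brings the point into the plane of the profile, at distance [rho] from the axis. *)
Lemma sor_meval (f : {mpoly R[3]}) (P2 : {mpoly R[2]}) (x y z : R) :
  SOR_xaxis f ->
  (forall x y : C, cmeval f (pt3 x y 0) = cmeval P2 (pt2 x (y ^+ 2))) ->
  f.@[rpt3 x y z] = P2.@[fun i : 'I_2 => [:: x; y ^+ 2 + z ^+ 2]`_i].
Proof.
move=> [rot _] prof; pose rho := Num.sqrt (y ^+ 2 + z ^+ 2).
have Erho : rho ^+ 2 = y ^+ 2 + z ^+ 2 by rewrite sqr_sqrtr ?addr_ge0 ?sqr_ge0.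
have prof0 : f.@[rpt3 x rho 0] = P2.@[fun i : 'I_2 => [:: x; y ^+ 2 + z ^+ 2]`_i].
  apply: (fmorph_inj (@toC R)); have := prof (toC x) (toC rho).
  rewrite (@cmeval_real _ f (rpt3 x rho 0)); last first.
    by case=> -[|[|[|//]]] Hi; rewrite /pt3 /rpt3 //= rmorph0.
  move=> E; apply: etrans E _; apply: cmeval_real; case=> -[|[|//]] Hi //=.
  by rewrite /pt2 /= -Erho rmorphXn.
(* The rotation divides by [rho]; if [rho = 0], then over the reals [y = z = 0]. *)
have [rho0|nzrho] := eqVneq rho 0.
  have /eqP : y ^+ 2 + z ^+ 2 = 0 by rewrite -Erho rho0 expr0n.
  rewrite paddr_eq0 ?sqr_ge0 // !expf_eq0 /= => /andP[/eqP y0 /eqP z0].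
  by rewrite -prof0 rho0 y0 z0.
(* The rotation with cosine [y / rho] and sine [- z / rho] takes [(y, z)] to [(rho, 0)]. *)
rewrite -prof0 -(rot (y / rho) (- z / rho)); last first.
  by rewrite !exprMn sqrrN -mulrDl -Erho -exprMn mulfV // expr1n.
apply: meval_eq => -[[|[|[|//]]] Hi]; rewrite /rpt3 //=.
  by rewrite mulNr mulNr opprK ![_ / rho * _]mulrAC -mulrDl -!expr2 -Erho expr2 mulfK.
by rewrite !mulNr ![_ / rho * _]mulrAC [z * y]mulrC addNr.
Qed.

Lemma sor_revolve (f : {mpoly R[3]}) (P2 : {mpoly R[2]}) :
  SOR_xaxis f ->
  (forall x y : C, cmeval f (pt3 x y 0) = cmeval P2 (pt2 x (y ^+ 2))) ->
  map_mpoly (@toC R) f = revolve (poly2_of (map_mpoly (@toC R) P2)).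
Proof.
move=> sor prof; apply/eqP; rewrite -subr_eq0; apply/eqP/mpoly_fun_eq0 => v.
rewrite mevalB meval_revolve ev2_cmeval -/(cmeval _ _).
rewrite (@cmeval_real _ f (fun i => (v i)%:R)) => [|i]; last by rewrite rmorph_nat.
rewrite (@meval_eq _ _ _ (rpt3 (v 0)%:R (v 1)%:R (v 2)%:R)); last first.
  by case=> -[|[|[|//]]] Hi; rewrite /rpt3 /=; congr (v _)%:R; apply: val_inj.
rewrite (sor_meval _ _ _ sor prof); apply/eqP; rewrite subr_eq0 eq_sym; apply/eqP.
apply: cmeval_real => -[[|[|//]] Hi]; rewrite /pt2 /= ?rmorph_nat //.
by rewrite rmorphD !rmorphXn !rmorph_nat.
Qed.

Lemma cmeval_sor (f : {mpoly R[3]}) (P2 : {mpoly R[2]}) (v : 'I_3 -> C) :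
  map_mpoly (@toC R) f = revolve (poly2_of (map_mpoly (@toC R) P2)) ->
  cmeval f v = cmeval P2 (pt2 (v 0) (v 1 ^+ 2 + v 2 ^+ 2)).
Proof. by rewrite /cmeval => ->; rewrite meval_revolve ev2_cmeval. Qed.

Lemma nonconst_map_mpoly n (P : {mpoly R[n]}) (c : C) :
  mnonconst P -> map_mpoly (@toC R) P <> c%:MP.
Proof.
rewrite /mnonconst !msizeE -(perm_big _ (msupp_map_mpoly P (fmorph_inj (@toC R)))).
by rewrite -msizeE => + E; rewrite E msizeC; case: (c != 0).
Qed.

Lemma ev2_const_const2 (A : {poly {poly C}}) (c : C) :
  (forall x y, ev2 A x y = c) -> const2 A.
Proof.
move=> Ac; exists c; apply/eqP; rewrite -subr_eq0; apply/eqP.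
apply/polyP => i; rewrite coef0; apply: poly_fun_eq0 => k.
have : map_poly (horner_eval k%:R) (A - c%:P%:P) = 0.
  apply: poly_fun_eq0 => l; rewrite -ev2_map /ev2 hornerD hornerN !hornerC.
  by rewrite hornerD hornerN hornerC -/(ev2 _ _ _) Ac subrr.
by move/(congr1 (fun u : {poly C} => u`_i)); rewrite coef_map coef0.
Qed.

(** Already on [z = 0], the form [y^2 + z^2] takes every complex value. *)
Lemma revolve_const2 (A : {poly {poly C}}) :
  ~~ mnonconst (revolve A) -> const2 A.
Proof.
rewrite /mnonconst -leqNgt => /msize1_polyC E.
apply: (@ev2_const_const2 _ (revolve A)@_0) => x y.
have /(congr1 (meval (pt3 x (sqrtC y) 0))) := E.
by rewrite mevalC meval_revolve /pt3 /= sqrtCK expr0n addr0.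
Qed.

Lemma irred2_profile (f : {mpoly R[3]}) (B : {poly {poly C}}) :
  abs_irreducible f -> map_mpoly (@toC R) f = revolve B -> irred2 B.
Proof.
move=> [ncf irrf] Ef; split=> [[c Bc]|A1 A2 EB].
  apply: (nonconst_map_mpoly (c := c) ncf); rewrite Ef Bc /revolve /= map_polyC.
  by rewrite /= /horner_eval map_polyC !hornerC.
have /irrf/orP : map_mpoly (@toC R) f = revolve A1 * revolve A2.
  by rewrite Ef EB /revolve rmorphM.
by case=> /revolve_const2; [left|right].
Qed.

(* A profile divisible by [y] would give [f] the factor
   [y^2 + z^2 = (y + i z) (y - i z)]. *)
Lemma profile_not_axis (f : {mpoly R[3]}) (B : {poly {poly C}}) :
  abs_irreducible f -> map_mpoly (@toC R) f = revolve B -> B.[0] <> 0.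
Proof.
move=> irrf Ef /rootP/factor_theorem[B' EB].
have [ncB irrB] := irred2_profile irrf Ef.
rewrite subr0 in EB; have [[k Ek]|[c /(congr1 (size \o polyseq))]] := irrB _ _ EB; last first.
  by rewrite /= size_polyX size_polyC; case: (c%:P != 0).
have sq2 : 'X_1 ^+ 2 + 'X_2 ^+ 2
    = ('X_1 + 'i%:MP * 'X_2) * ('X_1 - 'i%:MP * 'X_2) :> {mpoly C[3]}.
  rewrite mulrC -subr_sqr exprMn -rmorphXn /= sqrCi.
  by rewrite rmorphN1 mulN1r opprK.
have : map_mpoly (@toC R) f
    = ('X_1 + 'i%:MP * 'X_2) * (k%:MP * ('X_1 - 'i%:MP * 'X_2)).
  rewrite mulrCA -sq2 Ef EB Ek /revolve /= rmorphM /= map_polyC map_polyX /=.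
  by rewrite /horner_eval map_polyC hornerM !hornerC hornerX.
case: irrf => _ irrf /irrf/orP[]; rewrite -leqNgt => /msize1_polyC E.
  have := congr1 (meval (pt3 0 0 0 : _ -> C)) E.
  have := congr1 (meval (pt3 0 1 0 : _ -> C)) E.
  rewrite !mevalC !mevalD !mevalM !mevalC !mevalXU /pt3 /= mulr0 !addr0 => <- /eqP.
  by rewrite eq_sym oner_eq0.
(* The second factor carries the scalar [k]: if it is constant then [k = 0], so [B = 0], which is
   excluded. *)
have := congr1 (meval (pt3 0 0 0 : _ -> C)) E.
have := congr1 (meval (pt3 0 1 0 : _ -> C)) E.
rewrite !mevalM !mevalC !mevalB !mevalM !mevalC !mevalXU /pt3 /=.
rewrite !mulr0 !subr0 mulr1 mulr0 => <- k0; apply: ncB; exists 0.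
by rewrite EB Ek -k0 !polyC0 mul0r.
Qed.

End Revolution.

(** * Evaluation at complex points *)

Lemma forall_ord3 (P : 'I_3 -> Prop) : P 0 -> P 1 -> P 2 -> forall i, P i.
Proof.
move=> P0 P1 P2 [[|[|[|//]]] Hi].
- by rewrite (_ : Ordinal Hi = 0) //; apply: val_inj.
- by rewrite (_ : Ordinal Hi = 1) //; apply: val_inj.
- by rewrite (_ : Ordinal Hi = 2) //; apply: val_inj.
Qed.

Lemma homogenize_term (F : fieldType) (x y : F) n i : y != 0 -> (i <= n)%N ->
  x ^+ i * y ^+ (n - i) = y ^+ n * (x / y) ^+ i.
Proof.
move=> nzy le_in; rewrite -{2}(subnK le_in) exprD expr_div_n mulrAC -mulrA.
by rewrite mulrC divfK // expf_neq0.
Qed.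

Section Evaluation.
Variable R : rcfType.
Local Notation C := R[i].

Lemma cmevalD n (P Q : {mpoly R[n]}) v : cmeval (P + Q) v = cmeval P v + cmeval Q v.
Proof. by rewrite /cmeval rmorphD mevalD. Qed.

Lemma cmevalB n (P Q : {mpoly R[n]}) v : cmeval (P - Q) v = cmeval P v - cmeval Q v.
Proof. by rewrite /cmeval rmorphB mevalB. Qed.

Lemma cmevalM n (P Q : {mpoly R[n]}) v : cmeval (P * Q) v = cmeval P v * cmeval Q v.
Proof. by rewrite /cmeval rmorphM mevalM. Qed.

Lemma cmevalX n (P : {mpoly R[n]}) k v : cmeval (P ^+ k) v = cmeval P v ^+ k.
Proof. by rewrite /cmeval rmorphXn /= rmorphXn. Qed.

Lemma cmevalZ n (c : R) (P : {mpoly R[n]}) v : cmeval (c *: P) v = toC c * cmeval P v.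
Proof. by rewrite /cmeval map_mpolyZ mevalZ. Qed.

Lemma cmeval_sum n m (F : 'I_m -> {mpoly R[n]}) v :
  cmeval (\sum_i F i) v = \sum_i cmeval (F i) v.
Proof.
by rewrite /cmeval (raddf_sum (map_mpoly (@toC R))) (raddf_sum (meval v)).
Qed.

Lemma cmevalXU n (i : 'I_n) (v : 'I_n -> C) : cmeval 'X_i v = v i.
Proof. by rewrite /cmeval map_mpolyX mevalXU. Qed.

Lemma cmeval_upoly n (i : 'I_n) (u : {poly R}) (v : 'I_n -> C) :
  cmeval (upoly_in i u) v = cpeval u (v i).
Proof.
apply: etrans (esym (horner_map (meval v \o map_mpoly (@toC R)) _ _)) _.
rewrite /= map_mpolyX mevalXU -map_poly_comp.
congr (_.[_]); apply: eq_map_poly => c /=.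
by rewrite map_mpolyC mevalC.
Qed.

Lemma cpevalM (u w : {poly R}) (t : C) : cpeval (u * w) t = cpeval u t * cpeval w t.
Proof. by rewrite /cpeval rmorphM hornerM. Qed.

Lemma cpevalX (u : {poly R}) k (t : C) : cpeval (u ^+ k) t = cpeval u t ^+ k.
Proof. by rewrite /cpeval rmorphXn /= horner_exp. Qed.

(* [b ^ n * u (a / b)]; the truncated exponent [n - i] is exact only when
   [size u <= n.+1]. *)
Definition homogenize n (a b : {mpoly R[2]}) (u : {poly R}) : {mpoly R[2]} :=
  \sum_(i < n.+1) u`_i *: (a ^+ i * b ^+ (n - i)).

Lemma cmeval_homogenize n a b (u : {poly R}) (v : 'I_2 -> C) :
  (size u <= n.+1)%N -> cmeval b v != 0 ->
  cmeval (homogenize n a b u) v = cmeval b v ^+ n * cpeval u (cmeval a v / cmeval b v).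
Proof.
move=> su nzb; rewrite /cpeval (@horner_coef_wide _ n.+1); last first.
  by rewrite size_map_poly.
rewrite cmeval_sum mulr_sumr; apply: eq_bigr => i _.
rewrite cmevalZ cmevalM !cmevalX coef_map /= [RHS]mulrCA.
congr (_ * _); have le_in : (i <= n)%N by rewrite -ltnS.
exact: homogenize_term.
Qed.

(** The counterpart of [revolve] over the reals, since the components of an [rmap3] have real
    coefficients. *)
Definition lift3 (P : {mpoly R[2]}) : {mpoly R[3]} :=
  mmap (@mpolyC 3 R) (fun i : 'I_2 => [:: 'X_0; 'X_1 ^+ 2 + 'X_2 ^+ 2]`_i) P.

Lemma cmeval_lift3 (P : {mpoly R[2]}) (v : 'I_3 -> C) :
  cmeval (lift3 P) v = cmeval P (pt2 (v 0) (v 1 ^+ 2 + v 2 ^+ 2)).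
Proof.
have := @mpoly_rmorph_ext _ _ _
  ((meval v \o map_mpoly (@toC R)) \o
   mmap (@mpolyC 3 R) (fun i : 'I_2 => [:: 'X_0; 'X_1 ^+ 2 + 'X_2 ^+ 2]`_i))
  (meval (pt2 (v 0) (v 1 ^+ 2 + v 2 ^+ 2)) \o map_mpoly (@toC R)).
apply => [c|i].
  by rewrite /= mmapC !map_mpolyC !mevalC.
rewrite /= mmapX mmap1U -[LHS]/(cmeval _ v) -[RHS]/(cmeval _ _) cmevalXU.
case: i => -[|[|//]] Hi /=; rewrite ?cmevalD ?cmevalX !cmevalXU //.
Qed.

(** Along the parameterization [P] is a rational function whose denominator is a power of [q]; so if
    it is nonzero at one parameter, it is nonzero at all but finitely many. *)
Lemma param_numerator (P : {mpoly C[2]}) (p q r : {poly R}) :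
  exists N F, forall t, cpeval q t != 0 ->
    F.[t] = cpeval q t ^+ N * P.@[param_pt p q r t].
Proof.
elim/mpolyind: P => [|c m P _ _ [N [F IH]]].
  by exists 0%N, 0 => t _; rewrite meval0 horner0 mulr0.
pose m0 := m 0; pose m1 := m 1; pose pC := map_poly (@toC R).
(* [q ^ (m0 + m1)] clears the new monomial, and [q ^ N] the remaining terms. *)
exists (m0 + m1 + N)%N, (c *: (pC p ^+ m0 * pC r ^+ m1 * pC q ^+ N)
  + pC q ^+ (m0 + m1) * F) => t qt.
rewrite hornerD hornerZ !hornerM !horner_exp IH // mevalD mevalZ mevalX.
rewrite (_ : \prod_(i < 2) _
    = (cpeval p t / cpeval q t) ^+ m0 * (cpeval r t / cpeval q t) ^+ m1); last first.
  rewrite 2!big_ord_recl big_ord0 mulr1 /param_pt /pt2 /m0 /m1 /=.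
  by congr (_ ^+ m _ * _ ^+ m _); apply: val_inj.
rewrite -/(cpeval p t) -/(cpeval q t) -/(cpeval r t).
move: (cpeval p t) (cpeval q t) (cpeval r t) (P.@[_]) qt => a b e w nzb.
rewrite !exprD !expr_div_n mulrDr; congr (_ + _); last by rewrite mulrA.
have nz0 : b ^+ m0 != 0 by rewrite expf_neq0.
have nz1 : b ^+ m1 != 0 by rewrite expf_neq0.
move: (b ^+ m0) (b ^+ m1) nz0 nz1 => b0 b1 nz0 nz1.
by field; rewrite nz0 nz1.
Qed.
End Evaluation.

(** * The inverse of the parameterization and of tau *)

Local Opaque cmeval cpeval.

Lemma scale_cancel (F : fieldType) (y u w : F) : u != 0 -> w != 0 ->
  w * y / u * u / w = y.
Proof. by move=> nzu nzw; rewrite divfK // mulrAC divff // mul1r. Qed.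

Lemma scale_uncancel (F : fieldType) (y u w : F) : u != 0 -> w != 0 ->
  w * (y * u / w) / u = y.
Proof. by move=> nzu nzw; rewrite [w * _]mulrC divfK // mulfK. Qed.

Section Inverse.
Variables (R : rcfType) (P2 : {mpoly R[2]}) (p q r : {poly R}) (a b : {mpoly R[2]}).
Local Notation C := R[i].
Local Notation B := (poly2_of (map_mpoly (@toC R) P2)).
Local Notation pt := (param_pt p q r).
Hypotheses (irrB : irred2 B) (nzB0 : B.[0] <> 0) (nzq : q != 0).
Hypothesis (on_curve : forall t : C, cpeval q t != 0 -> cmeval P2 (pt t) = 0).
Hypothesis (b_nz : exists t : C, cpeval q t != 0 /\ cmeval b (pt t) != 0).
Hypothesis (inv_param : forall t : C, cpeval q t != 0 -> cmeval b (pt t) != 0 ->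
  cmeval a (pt t) = t * cmeval b (pt t)).

Let pC := map_poly (@toC R) p.
Let qC := map_poly (@toC R) q.
Let rC := map_poly (@toC R) r.

Let nzqC : qC != 0.
Proof. by rewrite map_poly_eq0. Qed.

Let cpevalE u (t : C) : (map_poly (@toC R) u).[t] = cpeval u t.
Proof. by []. Qed.

(** On a constant point [a] and [b] have fixed values, and [a = t b] with [b != 0] cannot hold for
    two parameters. *)
Lemma param_nonconst : ~ exists c1 c2 : C, pC = c1 *: qC /\ rC = c2 *: qC.
Proof.
move=> [c1 [c2 [Ep Er]]]; have [t0 [qt0 bt0]] := b_nz.
have Ept t : cpeval q t != 0 -> pt t = pt2 c1 c2.
  by move=> qt; rewrite /param_pt -!cpevalE -/pC -/rC Ep Er !hornerZ !mulfK.
have /closed_nonrootP[t1] : qC * ('X - t0%:P) != 0.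
  by rewrite mulf_neq0 // polyXsubC_eq0.
rewrite rootM negb_or root_XsubC => /andP[qt1]; apply/negP/negPn/eqP.
have bt1 : cmeval b (pt t1) != 0 by rewrite Ept // -(Ept t0).
apply: (mulIf bt0); rewrite -inv_param // Ept // -(Ept t1) //.
by rewrite inv_param.
Qed.

(** If [r = 0], the curve lies on [y = 0] and [p / q] is nonconstant, so [B.[0]] has infinitely many
    roots. *)
Lemma param_r_neq0 : r != 0.
Proof.
apply/eqP => r0; apply: nzB0.
apply: (ratfun_poly_eq0 nzqC (p := pC)) => [c|t qt].
  apply/eqP => Ep; apply: param_nonconst; exists c, 0; split=> //.
  by rewrite scale0r /rC r0 rmorph0.
have := on_curve qt; rewrite /param_pt r0.
have -> : cpeval 0 t = 0 :> C by rewrite -cpevalE rmorph0 horner0.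
by rewrite mul0r -ev2_cmeval /ev2 polyC0.
Qed.

(** Each condition excludes finitely many parameters, the one on [b] through its numerator. *)
Lemma param_generic (u : {poly R}) : u != 0 ->
  exists t : C, [/\ cpeval q t != 0, cpeval u t != 0 & cmeval b (pt t) != 0].
Proof.
move=> nzu; have [N [F EF]] := param_numerator (map_mpoly (@toC R) b) p q r.
have [t0 [qt0 bt0]] := b_nz.
have nzF : F != 0.
  apply: contra_neq bt0 => F0; have /eqP := EF _ qt0.
  by rewrite F0 horner0 eq_sym mulf_eq0 expf_eq0 (negPf qt0) andbF => /eqP.
have /closed_nonrootP[t] : qC * map_poly (@toC R) u * F != 0.
  by rewrite !mulf_neq0 // map_poly_eq0.
rewrite !rootM !negb_or => /andP[/andP[qt ut]] /rootP Ft; exists t; split=> //.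
by apply: contra_not_neq Ft => bt; rewrite EF // [meval _ _]bt mulr0.
Qed.

Lemma param_vanish (G : {mpoly R[2]}) :
  (forall t : C, cpeval q t != 0 -> cmeval b (pt t) != 0 -> cmeval G (pt t) = 0) ->
  forall x y : C, cmeval P2 (pt2 x y) = 0 -> cmeval b (pt2 x y) != 0 ->
  cmeval G (pt2 x y) = 0.
Proof.
(* The factor [b] makes the product vanish at all parameters with [q != 0], including those with
   [b = 0]. *)
move=> G0 x y P0 nzb; have : cmeval (G * b) (pt2 x y) = 0.
  rewrite -ev2_cmeval; apply: (irred2_param_zero irrB nzqC param_nonconst).
  - by move=> t qt; rewrite ev2_cmeval; apply: on_curve.
  - move=> t qt; rewrite ev2_cmeval -/(pt t) cmevalM.
    have [->|bt] := eqVneq (cmeval b (pt t)) 0; first by rewrite mulr0.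
    by rewrite G0 // mul0r.
  - by rewrite ev2_cmeval.
by rewrite cmevalM => E; apply: (mulIf nzb); rewrite E mul0r.
Qed.

Lemma param_inverse_coord (i : 'I_2) (u : {poly R}) :
  (forall t : C, pt t i = cpeval u t / cpeval q t) ->
  forall x y : C, cmeval P2 (pt2 x y) = 0 -> cmeval b (pt2 x y) != 0 ->
  let t := cmeval a (pt2 x y) / cmeval b (pt2 x y) in
  cpeval q t != 0 -> pt2 x y i = cpeval u t / cpeval q t.
Proof.
move=> Eu x y P0 nzb t qt; pose n := (size q + size u)%N.
have sq : (size q <= n.+1)%N by rewrite leqW // leq_addr.
have su : (size u <= n.+1)%N by rewrite leqW // leq_addl.
(* The relation [x_i q(t) = u(t)] at [t = a / b], multiplied by [b ^ n]. *)
have /(param_vanish (G := 'X_i * homogenize n a b q - homogenize n a b u)) := P0.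
rewrite cmevalB cmevalM cmevalXU !cmeval_homogenize // -/t.
move=> H; apply: (mulIf qt); rewrite divfK //.
have bn : cmeval b (pt2 x y) ^+ n != 0 by rewrite expf_neq0.
apply: (mulfI bn); apply/eqP; rewrite -subr_eq0 mulrCA H // => s qs bs.
rewrite cmevalB cmevalM cmevalXU !cmeval_homogenize // inv_param // mulfK //.
by rewrite Eu mulrCA divfK // subrr.
Qed.

Lemma param_inverse (x y : C) :
  cmeval P2 (pt2 x y) = 0 -> cmeval b (pt2 x y) != 0 ->
  let t := cmeval a (pt2 x y) / cmeval b (pt2 x y) in
  cpeval q t != 0 -> x = cpeval p t / cpeval q t /\ y = cpeval r t / cpeval q t.
Proof.
move=> P0 nzb t qt; split.
  by apply: (param_inverse_coord (i := 0) (u := p) _ P0).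
by apply: (param_inverse_coord (i := 1) (u := r) _ P0).
Qed.

End Inverse.

Lemma tau_mapP (R : rcfType) (p q qt d : {poly R}) (v : 'I_3 -> R[i]) :
  [/\ rdefined (tau_map p q qt d) v <-> cpeval q (v 0) != 0 /\ cpeval qt (v 0) != 0,
      rapply (tau_map p q qt d) v 0 = cpeval p (v 0) / cpeval q (v 0),
      rapply (tau_map p q qt d) v 1 = cpeval d (v 0) * v 1 / cpeval qt (v 0)
    & rapply (tau_map p q qt d) v 2 = cpeval d (v 0) * v 2 / cpeval qt (v 0)].
Proof.
split; rewrite /rapply /rdefined /tau_map /= ?cmevalM ?cmeval_upoly ?cmevalXU //.
split=> [H|[q0 qt0]].
  by have := H 0; have := H 1; rewrite /= !cmeval_upoly.
by apply: forall_ord3; rewrite /= cmeval_upoly.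
Qed.

Section InverseMap.
Variables (R : rcfType) (a b : {mpoly R[2]}) (q qt d : {poly R}).

(** One exponent bounding all three sizes, so that the powers of [b] from homogenization agree and
    cancel. *)
Definition tau_inv_degree := (size q + size qt + size d)%N.

Local Notation H := (homogenize tau_inv_degree a b).

(* [(a / b, y qt(a/b) / d(a/b), z qt(a/b) / d(a/b))] evaluated at
   [(x, y^2 + z^2)], brought to a common denominator that also vanishes where
   [q(a/b)] does. *)
Definition tau_inv : rmap3 R :=
  fun i => (lift3 ([:: a * H q * H d; b * H q * H qt; b * H q * H qt]`_i)
             * [:: 1; 'X_1; 'X_2]`_i,
            lift3 (b * H q * H d)).

Lemma tau_invP (v : 'I_3 -> R[i]) :
  let w := pt2 (v 0) (v 1 ^+ 2 + v 2 ^+ 2) in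
  let t := cmeval a w / cmeval b w in
  [/\ rdefined tau_inv v <->
        [/\ cmeval b w != 0, cpeval q t != 0 & cpeval d t != 0],
      rdefined tau_inv v -> rapply tau_inv v 0 = t,
      rdefined tau_inv v -> rapply tau_inv v 1
        = v 1 * cpeval qt (rapply tau_inv v 0) / cpeval d (rapply tau_inv v 0)
    & rdefined tau_inv v -> rapply tau_inv v 2
        = v 2 * cpeval qt (rapply tau_inv v 0) / cpeval d (rapply tau_inv v 0)].
Proof.
move=> w t.
have sz (u : {poly R}) : (size u <= tau_inv_degree)%N -> cmeval b w != 0 ->
    cmeval (H u) w = cmeval b w ^+ tau_inv_degree * cpeval u t.
  by move=> su nzb; rewrite cmeval_homogenize // leqW.
have sq : (size q <= tau_inv_degree)%N by rewrite /tau_inv_degree -addnA leq_addr.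
have sd : (size d <= tau_inv_degree)%N by rewrite /tau_inv_degree leq_addl.
have sqt : (size qt <= tau_inv_degree)%N.
  by rewrite /tau_inv_degree addnAC leq_addl.
have iff1 : rdefined tau_inv v <->
    [/\ cmeval b w != 0, cpeval q t != 0 & cpeval d t != 0].
  have E i : cmeval (tau_inv i).2 v = cmeval b w * cmeval (H q) w * cmeval (H d) w.
    by rewrite cmeval_lift3 !cmevalM.
  split=> [/(_ 0)|[b0 q0 d0] i]; rewrite E.
    rewrite !mulf_eq0 !negb_or => /andP[/andP[b0]]; rewrite !sz //.
    by rewrite !mulf_eq0 !negb_or => /andP[_ ->] /andP[_ ->].
  by rewrite !sz // !mulf_neq0 // expf_neq0.
have E1 : cmeval (1 : {mpoly R[3]}) v = 1.
  by rewrite -(expr0 'X_0) cmevalX expr0.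
have E0 : rdefined tau_inv v -> rapply tau_inv v 0 = t.
  rewrite iff1 => -[b0 q0 d0].
  rewrite /rapply /tau_inv /= cmevalM !cmeval_lift3 E1 -/w !cmevalM !sz //.
  move: (cpeval q t) (cpeval d t) q0 d0; rewrite /t.
  move: (cmeval a w) (cmeval b w) b0 => a' b' b0 q' d' q0 d0.
  move: (b' ^+ _) (expf_neq0 tau_inv_degree b0) => bn nzbn.
  by field; rewrite nzbn b0 q0 d0.
split=> // dv; rewrite (E0 dv); have [b0 q0 d0] := iff1.1 dv;
  rewrite /rapply /tau_inv /= cmevalM !cmeval_lift3 cmevalXU -/w !cmevalM !sz //.
  move: (cmeval b w ^+ _) (expf_neq0 tau_inv_degree b0) (v 1) => bn nzbn y.
  move: (cmeval b w) (cpeval q t) (cpeval qt t) (cpeval d t) b0 q0 d0.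
  by move=> b' q' qt' d' b0 q0 d0; field; rewrite nzbn b0 q0 d0.
move: (cmeval b w ^+ _) (expf_neq0 tau_inv_degree b0) (v 2) => bn nzbn y.
move: (cmeval b w) (cpeval q t) (cpeval qt t) (cpeval d t) b0 q0 d0.
by move=> b' q' qt' d' b0 q0 d0; field; rewrite nzbn b0 q0 d0.
Qed.
End InverseMap.

(** * The birational equivalence *)

Theorem theorem3 (R : rcfType) (f : {mpoly R[3]}) (P2 : {mpoly R[2]})
    (p q r : {poly R}) (h d : {poly R}) :
  abs_irreducible f ->
  SOR_xaxis f ->
  (* profile curve: f(x,y,0) = sum_i p_i(x) y^(2i) and P2(x,y) = sum_i p_i(x) y^i *)
  (forall x y : R[i], cmeval f (pt3 x y 0) = cmeval P2 (pt2 x (y ^+ 2))) ->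
  proper_param P2 p q r ->
  let g := gcdp r q in
  let rt := r %/ g in
  let qt := q %/ g in
  rt * qt = h * d ^+ 2 ->
  squarefree h ->
  birational (tubular h) f (tau_map p q qt d).
Proof.
move=> irrf sor prof [nzq [on_curve [a [b [b_nz inv_param]]]]] g rt qt Ehd _.
have Ef := sor_revolve sor prof.
have irrB := irred2_profile irrf Ef.
have nzB0 := profile_not_axis irrf Ef.
have nzr := param_r_neq0 nzB0 nzq on_curve b_nz inv_param.
have Er : r = rt * g by rewrite divpK // dvdp_gcdl.
have Eq : q = qt * g by rewrite divpK // dvdp_gcdr.
have nzd : d != 0.
  apply: contraNneq nzr => d0; move: Ehd; rewrite d0 expr0n mulr0 => /eqP.
  rewrite mulf_eq0 => /orP[/eqP rt0|/eqP qt0]; first by rewrite Er rt0 mul0r.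
  by rewrite Eq qt0 mul0r eqxx in nzq.
have qtP (t : R[i]) : cpeval q t != 0 -> cpeval qt t != 0.
  by rewrite Eq cpevalM mulf_eq0 negb_or => /andP[].
(* Extending [rt / qt] by [qt] gives the numerator [rt qt = h d^2]. *)
have ratioE (t : R[i]) : cpeval q t != 0 ->
    cpeval r t / cpeval q t = cpeval d t ^+ 2 * cpeval h t / cpeval qt t ^+ 2.
  move=> qt0; have nzqt := qtP t qt0.
  have -> : cpeval d t ^+ 2 * cpeval h t = cpeval rt t * cpeval qt t.
    by rewrite mulrC -cpevalX -!cpevalM Ehd.
  move: qt0; rewrite Eq Er !cpevalM mulf_eq0 negb_or => /andP[_ nzg].
  by rewrite -mulf_div divff // mulr1 expr2 invfM mulrA mulfK.
have tubP (v : 'I_3 -> R[i]) :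
    onV (tubular h) v <-> v 1 ^+ 2 + v 2 ^+ 2 = cpeval h (v 0).
  rewrite /onV /tubular cmevalB cmevalD !cmevalX !cmevalXU cmeval_upoly.
  by split=> [/eqP|->]; rewrite ?subrr // subr_eq0 => /eqP.
have sorP (v : 'I_3 -> R[i]) :
    onV f v <-> cmeval P2 (pt2 (v 0) (v 1 ^+ 2 + v 2 ^+ 2)) = 0.
  by rewrite /onV (cmeval_sor _ Ef).
pose tau := tau_map p q qt d.
pose psi := tau_inv a b q qt d.
(* [tau] sends the section of the tubular surface over a parameter into the circle swept by the
   profile point with that parameter. *)
have tau_pt (v : 'I_3 -> R[i]) : onV (tubular h) v -> rdefined tau v ->
    pt2 (rapply tau v 0) (rapply tau v 1 ^+ 2 + rapply tau v 2 ^+ 2)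
    = param_pt p q r (v 0).
  move=> /tubP Tv; have [-> -> -> ->] := tau_mapP p q qt d v => -[q0 qt0].
  rewrite /param_pt ratioE //; congr (pt2 _ _).
  by rewrite !exprMn !exprVn -!mulrDl -mulrDr Tv.
have psi_pt (v : 'I_3 -> R[i]) : onV f v -> rdefined psi v ->
    let t := rapply psi v 0 in
    [/\ cpeval q t != 0, cpeval d t != 0,
        v 0 = cpeval p t / cpeval q t
      & v 1 ^+ 2 + v 2 ^+ 2 = cpeval r t / cpeval q t].
  move=> /sorP Fv dv; have [def E0 _ _] := tau_invP a b q qt d v.
  rewrite /= E0 //; have [b0 q0 d0] := def.1 dv.
  have [Ex Ey] := param_inverse irrB nzq on_curve b_nz inv_param Fv b0 q0.
  by split.
have psi_tau (v : 'I_3 -> R[i]) : onV (tubular h) v -> rdefined tau v ->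
    rdefined psi (rapply tau v) -> forall i, rapply psi (rapply tau v) i = v i.
  move=> Tv dv dp; have [def E0 E1 E2] := tau_invP a b q qt d (rapply tau v).
  have [tdef _ T1 T2] := tau_mapP p q qt d v; have [q0 qt0] := tdef.1 dv.
  have [b0 _ d0] := def.1 dp.
  (* On a parameterized point [a / b] is the parameter itself, here [v 0]. *)
  rewrite tau_pt // in b0 d0 E0; rewrite inv_param // mulfK // in d0 E0.
  rewrite E0 // in E1 E2.
  apply: forall_ord3; first exact: E0.
    by rewrite E1 // T1 scale_cancel.
  by rewrite E2 // T2 scale_cancel.
have tau_psi (v : 'I_3 -> R[i]) : onV f v -> rdefined psi v ->
    rdefined tau (rapply psi v) -> forall i, rapply tau (rapply psi v) i = v i.
  move=> Fv dv dt; have [_ _ E1 E2] := tau_invP a b q qt d v.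
  have [_ T0 T1 T2] := tau_mapP p q qt d (rapply psi v).
  have [q0 d0 Ex _] := psi_pt v Fv dv; have qt0 := qtP _ q0.
  apply: forall_ord3; first exact: etrans T0 (esym Ex).
    by apply: (etrans T1); rewrite (E1 dv) scale_uncancel.
  by apply: (etrans T2); rewrite (E2 dv) scale_uncancel.
have tau_on (v : 'I_3 -> R[i]) : onV (tubular h) v -> rdefined tau v ->
    onV f (rapply tau v).
  move=> Tv dv; apply/sorP; rewrite tau_pt //; apply: on_curve.
  by have [def _ _ _] := tau_mapP p q qt d v; have [] := def.1 dv.
have psi_on (v : 'I_3 -> R[i]) : onV f v -> rdefined psi v ->
    onV (tubular h) (rapply psi v).
  move=> Fv dv; have [_ _ E1 E2] := tau_invP a b q qt d v.
  have [q0 d0 _ Ey] := psi_pt v Fv dv; have qt0 := qtP _ q0.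
  apply/tubP; rewrite (E1 dv) (E2 dv) !expr_div_n !exprMn -!mulrDl Ey ratioE //.
  by rewrite divfK ?expf_neq0 // mulrAC mulfV ?mul1r // expf_neq0.
(* One parameter outside the zeros of [q], [d] and [b] supplies every point at which a map or
   composition must be defined. *)
have [t [q0 d0 b0]] := param_generic nzq b_nz nzd.
have qt0 := qtP t q0.
(* The complex square root exists whatever the value of [h] at [t]. *)
pose T := pt3 t (sqrtC (cpeval h t)) 0.
have T_on : onV (tubular h) T.
  by apply/tubP; rewrite /T /pt3 /= sqrtCK expr0n addr0.
have T_def : rdefined tau T.
  by have [def _ _ _] := tau_mapP p q qt d T; apply/def.
have X_def : rdefined psi (rapply tau T).
  have [def _ _ _] := tau_invP a b q qt d (rapply tau T); apply/def.
  by rewrite tau_pt // inv_param // mulfK.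
have X_on := tau_on T T_on T_def.
split; first by split; [exists T | exact: tau_on].
exists psi; split; first by split; [exists (rapply tau T) | exact: psi_on].
split; first by exists T.
split; last by split; [exact: psi_tau | exact: tau_psi].
(* [psi] sends this point back to [T], where [tau] is defined. *)
exists (rapply tau T); split; [exact: X_on | split; first exact: X_def].
have [def _ _ _] := tau_mapP p q qt d (rapply psi (rapply tau T)); apply/def.
by rewrite psi_tau.
Qed.
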